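(* Let $k\ge2$ and $d\ge 1$ be integers, let $\beta$ be an integer greater than $1$, and let ${\bf a}=(a(n))_{n\ge0}$ be a sequence with values in $\{0,1,\dots,\beta-1\}$. Suppose there exists an injective coding $\tau:\{0,1,\dots,\beta-1\}^*\to\mathbb{C}^*$ such that the sequence ${\bf b}=(\tau(a(n)))_{n\ge0}$, with values in $\mathbb{C}$, is generalized $(k,d)$-regular. Then for every positive integer $m$, $$p_{\bf a}(m)\le(\beta+1)^{2d}\,k\,m.$$
   Context: For a set $A$, $A^*$ is the free monoid of words over $A$. A coding is a letter-to-letter monoid morphism, i.e. it is induced by a map $\{0,1,\dots,\beta-1\}\to\mathbb{C}$ on letters; it is injective iff this map is. For a sequence ${\bf b}=(b(n))_{n\ge0}$ with values in $\mathbb{C}$ and an integer $e\ge0$, let $S_e({\bf b})=\{(b(k^en+j))_{n\ge0} : 0\le j\le k^e-1\}$. The sequence ${\bf b}$ is generalized $(k,d)$-regular if for every $e\ge0$ the $\mathbb{C}$-vector subspace (of the space of complex sequences) spanned by $S_e({\bf b})$ has dimension at most $d$. The complexity function of ${\bf a}$ is $p_{\bf a}(m)=\#\{a(j)a(j+1)\cdots a(j+m-1) : j\ge0\}$, the number of distinct words of length $m$ occurring in ${\bf a}$. *)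

(* Defs.v *)
From HB Require Import structures.
From mathcomp Require Import all_boot all_order all_algebra.
From mathcomp Require Import boolp classical_sets functions reals.
From mathcomp Require Import complex.

Set Implicit Arguments.
Unset Strict Implicit.
Unset Printing Implicit Defensive.

Import Order.TTheory GRing.Theory Num.Theory.

Local Open Scope classical_set_scope.
Local Open Scope ring_scope.

(* Linear algebra inside a possibly infinite-dimensional space: MathComp's
   \dim only exists for the finite-dimensional vectType. *)
Section Dimension.
Variables (K : fieldType) (V : lmodType K).

Definition lin_span (X : set V) : set V :=
  [set v | exists n (c : 'I_n -> K) (x : 'I_n -> V),
     (forall i, X (x i)) /\ v = \sum_(i < n) c i *: x i].

Definition lin_indep n (x : 'I_n -> V) : Prop :=
  forall c : 'I_n -> K, \sum_(i < n) c i *: x i = 0 -> forall i, c i = 0.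

Definition has_dim (W : set V) (r : nat) : Prop :=
  exists x : 'I_r -> V, lin_indep x /\ lin_span (range x) = W.

Definition dim_at_most (W : set V) (d : nat) : Prop :=
  exists2 r : nat, (r <= d)%N & has_dim W r.

End Dimension.

Section Sequences.
Variable K : fieldType.

(* Sequences take values in K^o so that nat -> K^o carries the pointwise
   K-vector space structure. *)
Definition kernel_level (k e : nat) (b : nat -> K^o) : set (nat -> K^o) :=
  [set s | exists2 j : nat, (j < k ^ e)%N &
             s = fun n : nat => b (k ^ e * n + j)%N].

Definition generalized_regular (k d : nat) (b : nat -> K^o) : Prop :=
  forall e : nat, dim_at_most (lin_span (kernel_level k e b)) d.

End Sequences.

Definition is_coding (A B : Type) (tau : seq A -> seq B) : Prop :=
  [/\ tau [::] = [::],
      {morph tau : u v / u ++ v} &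
      forall x : A, size (tau [:: x]) = 1%N].

Definition factor_at (A : Type) (a : nat -> A) (m j : nat) : m.-tuple A :=
  [tuple a (j + i)%N | i < m].

Definition complexity (A : finType) (a : nat -> A) (m : nat) : nat :=
  #|[pred w : m.-tuple A | `[< exists j : nat, w = factor_at a m j >]]|.

(* Main.v *)
Require Import Defs.
From mathcomp Require Import all_boot all_order all_algebra.
From mathcomp Require Import boolp classical_sets functions reals.
From mathcomp Require Import complex.
From mathcomp Require Import zify.

Import GRing.Theory.

(** Put [L = k ^ e], and list the blocks [b (L * n), ..., b (L * n + L - 1)] as
    the columns of a matrix with [L] rows. Its rows are the sequences of the
    [e]-th level of the kernel, so its rank is at most [d]: some [r <= d] of its
    rows generate all the others, and a block is known once its entries in
    these [r] positions are ([finite_rank_sampling]). As the letters of [b]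
    are in bijection with those of [a], at most [beta ^ d] blocks of length [L]
    occur in [a].

    If [m <= L], a factor of [a] of length [m] lies inside two consecutive
    blocks, and is determined by these two blocks and by its offset in the first
    one. This leaves at most [beta ^ (2 * d) * L] factors
    ([complexity_of_sampling]). Taking for [L] the least power of [k] exceeding
    [m] gives [L <= k * m], hence the bound, even with [beta] in place of
    [beta + 1]. *)

(** The sampled positions [f] are the indices of a maximal independent set of
    rows of the coefficient matrix [C] which expresses the [s j] in terms of the
    [x i]: the rows of [C] are combinations of the rows in [f], and the same
    combinations give the values [s j n] from the values [s (f i) n], whatever
    [n] is. *)
Lemma finite_rank_sampling (K : fieldType) (L d : nat) (s : 'I_L -> nat -> K^o)
    (W : set (nat -> K^o)) :
  dim_at_most W d -> (forall j, W (s j)) ->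
  exists2 r : nat, (r <= d)%N & exists f : 'I_r -> 'I_L,
    forall n n', (forall i, s (f i) n = s (f i) n') ->
    forall j, s j n = s j n'.
Proof.
move=> [p le_pd [x [_ spanW]]] sW.
have rowC j : exists c : 'I_p -> K, s j = (\sum_(i < p) c i *: x i)%R.
  have := sW j; rewrite -spanW => -[q [c [y [yx ->]]]].
  have /choice[g gE] : forall i : 'I_q, exists l, x l = y i.
    by move=> i; have [l _ <-] := yx i; exists l.
  exists (fun l => \sum_(i < q | g i == l) c i)%R.
  rewrite (partition_big g xpredT) //=; apply: eq_bigr => l _.
  by rewrite scaler_suml; apply: eq_bigr => i /eqP <-; rewrite gE.
have /choice[c cE] := rowC.
pose C := (\matrix_(j < L, i < p) c j i)%R.
pose u n : 'cV[K]_p := (\col_i x i n)%R.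
have sE j n : s j n = (C *m u n)%R j ord0.
  rewrite cE fct_sumE mxE; apply: eq_bigr => i _.
  by rewrite !mxE.
exists (\rank C); first exact: leq_trans (rank_leq_col C) le_pd.
exists (maxrankfun C) => n n' eq_f j.
have /submxP[D CE] : (C <= rowsub (maxrankfun C) C)%MS.
  by rewrite eq_maxrowsub.
have eq_u : (rowsub (maxrankfun C) C *m u n = rowsub (maxrankfun C) C *m u n')%R.
  apply/colP => i; rewrite !mul_rowsub_mx mxE [RHS]mxE.
  by have := eq_f i; rewrite !sE.
by rewrite !sE CE -!mulmxA eq_u.
Qed.

(** A factor is encoded by the offset of one of its occurrences in the block
    where it starts, and by the letters sampled from this block and the next;
    the samples give back both blocks, so the code is injective. *)
Lemma complexity_of_sampling (A : finType) (a : nat -> A) (L r m : nat)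
    (f : 'I_r -> 'I_L) :
  (forall n n', (forall i, a (L * n + f i)%N = a (L * n' + f i)%N) ->
     forall j : 'I_L, a (L * n + j)%N = a (L * n' + j)%N) ->
  (0 < L)%N -> (m <= L)%N -> (complexity a m <= #|A| ^ (2 * r) * L)%N.
Proof.
move=> samp L0 le_mL; rewrite /complexity.
set P := [pred w | _].
have /choice[pos posE] : forall w : m.-tuple A, exists j,
    P w -> w = factor_at a m j.
  move=> w; have [[j wj]|nw] := pselect (exists j, w = factor_at a m j).
    by exists j.
  by exists 0%N => /asboolP /nw.
pose sample n := [ffun i : 'I_r => a (L * n + f i)%N].
pose code w := (Ordinal (ltn_pmod (pos w) L0),
                (sample (pos w %/ L)%N, sample (pos w %/ L).+1)).
have sampleP n n' j : sample n = sample n' -> (j < L)%N ->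
    a (L * n + j)%N = a (L * n' + j)%N.
  move=> eq_s lt_jL; apply: (samp n n' _ (Ordinal lt_jL)) => i.
  by move/ffunP/(_ i): eq_s; rewrite !ffunE.
have code_inj : {in P &, injective code}.
  move=> w w' Pw Pw' [eq_o eq_q eq_q1].
  rewrite (posE w Pw) (posE w' Pw'); apply: eq_from_tnth => i.
  rewrite !tnth_mktuple.
  have lt_iL : (i < L)%N := leq_trans (ltn_ord i) le_mL.
  have lt_oL := ltn_pmod (pos w) L0.
  rewrite (divn_eq (pos w) L) (divn_eq (pos w') L) -eq_o -!addnA.
  case: (ltnP (pos w %% L + i) L) => [lt_L|ge_L].
    by rewrite ![(_ * L)%N]mulnC; apply: sampleP.
  (* The factor has crossed into the second block; since [m <= L] it cannot
     reach a third one. *)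
  have lt2 : (pos w %% L + i - L < L)%N by lia.
  by have := sampleP _ _ _ eq_q1 lt2; rewrite !mulnS ![(_ * L)%N]mulnC
    ![(L + _)%N]addnC -!addnA subnKC.
rewrite -(card_in_image code_inj) (leq_trans (max_card _)) //.
by rewrite !card_prod !card_ffun !card_ord mulnC mul2n -addnn expnD.
Qed.

(* A letter x is the one-letter word [:: x]: the third condition says that
   b n is the letter tau (a n). *)
Theorem theorem4p2 (R : realType) (k d beta : nat)
    (hk : (2 <= k)%N) (hd : (1 <= d)%N) (hbeta : (1 < beta)%N)
    (a : nat -> 'I_beta)
    (hreg : exists (tau : seq 'I_beta -> seq (complex R)) (b : nat -> complex R),
       [/\ is_coding tau,
           injective tau,
           forall n : nat, tau [:: a n] = [:: b n] &
           generalized_regular k d b]) :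
  forall m : nat, (0 < m)%N ->
    (complexity a m <= (beta + 1) ^ (2 * d) * k * m)%N.
Proof.
move=> m m_gt0; have [tau [b [_ tau_inj tauE breg]]] := hreg.
have ab n n' : a n = a n' <-> b n = b n'.
  split=> [eq_a|eq_b]; first by have := tauE n; rewrite eq_a tauE => -[].
  by have /tau_inj[] : tau [:: a n] = tau [:: a n'] by rewrite !tauE eq_b.
pose e := (trunc_log k m).+1; pose L := (k ^ e)%N.
have /andP[le_km lt_mL] := trunc_log_bounds hk m_gt0.
pose s (j : 'I_L) n := b (L * n + j)%N.
have s_span j : lin_span (kernel_level k e b) (s j).
  exists 1%N, (fun=> 1%R), (fun=> s j).
  by split; [move=> _; exists j | rewrite big_ord1 scale1r].
have [r le_rd [f fP]] := finite_rank_sampling _ _ _ _ _ (breg e) s_span.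
have samp n n' : (forall i, a (L * n + f i)%N = a (L * n' + f i)%N) ->
    forall j : 'I_L, a (L * n + j)%N = a (L * n' + j)%N.
  by move=> eq_a j; apply/ab/fP => i; apply/ab.
have L_gt0 : (0 < L)%N by rewrite expn_gt0 ltnW.
apply: leq_trans (complexity_of_sampling _ _ _ _ m _ samp L_gt0 (ltnW lt_mL)) _.
rewrite card_ord -mulnA leq_mul //; last by rewrite /L expnS leq_mul2l le_km orbT.
apply: (@leq_trans (beta ^ (2 * d))); last by rewrite leq_exp2r ?muln_gt0 ?addn1.
by rewrite leq_pexp2l ?leq_mul2l ?(ltnW hbeta).
Qed.
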